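(* For all integers $s\ge 8$ and $t\ge 1$, there exists a Kneser graph $G$ with chromatic number $\chi(G)=s$ which contains the complete graph $K_t$ as a totally odd subdivision.
   Context: All graphs are finite, undirected and loopless. Write $[n]=\{1,\dots,n\}$. For integers $n\ge k\ge 1$, the Kneser graph $KG(n,k)$ has as vertices all $k$-element subsets of $[n]$, two of them being adjacent if and only if their intersection is empty. A Kneser graph is a graph of the form $KG(n,k)$. A graph $G$ contains a graph $H$ as a totally odd subdivision if there are an injection $\varphi\colon V(H)\to V(G)$ and, for every edge $uv\in E(H)$, a path $P_{uv}$ in $G$ with endpoints $\varphi(u)$ and $\varphi(v)$ and of odd length (number of edges), such that the paths $P_{uv}$ ($uv\in E(H)$) are pairwise edge-disjoint and pairwise internally vertex-disjoint, and no vertex of $\varphi(V(H))$ (these vertices are called terminals) is an internal vertex of any of these paths. *)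

(* Defs.v *)
From mathcomp Require Import all_boot.

Set Implicit Arguments.
Unset Strict Implicit.
Unset Printing Implicit Defensive.

Record sgraph := SGraph {
  vertex :> finType;
  adj : rel vertex;
  adj_sym : symmetric adj;
  adj_irrefl : irreflexive adj
}.

Definition edges (G : sgraph) : {set {set G}} :=
  [set [set u; v] | u in G, v in G & adj u v].

Definition colorable (G : sgraph) (m : nat) : bool :=
  [exists f : {ffun G -> 'I_m},
     [forall u : G, forall v : G, adj u v ==> (f u != f v)]].

Lemma colorable_ex (G : sgraph) : exists m, colorable G m.
Proof.
exists #|G|; apply/existsP; exists [ffun u => enum_rank u].
apply/forallP=> u; apply/forallP=> v; apply/implyP=> uv; rewrite !ffunE.
by apply: contraTneq uv => /enum_rank_inj ->; rewrite adj_irrefl.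
Qed.

Definition chi (G : sgraph) : nat := ex_minn (colorable_ex G).

Definition complete_adj (t : nat) : rel 'I_t := [rel u v | u != v].

Lemma complete_adj_sym t : symmetric (@complete_adj t).
Proof. by move=> u v; rewrite /complete_adj /= eq_sym. Qed.

Lemma complete_adj_irrefl t : irreflexive (@complete_adj t).
Proof. by move=> u; rewrite /complete_adj /= eqxx. Qed.

Definition complete_graph (t : nat) : sgraph :=
  SGraph (@complete_adj_sym t) (@complete_adj_irrefl t).

(* The ground set [n] is 'I_n. *)
Definition ksubset (n k : nat) : finType := {A : {set 'I_n} | #|A| == k}.

Definition kneser_adj (n k : nat) : rel (ksubset n k) :=
  [rel A B | val A :&: val B == set0].

Lemma kneser_adj_sym n k : symmetric (@kneser_adj n k).
Proof. by move=> A B; rewrite /kneser_adj /= setIC. Qed.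

(* For k = 0 the only vertex would be a loop. *)
Lemma kneser_adj_irrefl n k : 0 < k -> irreflexive (@kneser_adj n k).
Proof.
move=> k_gt0 A; rewrite /kneser_adj /= setIid -cards_eq0 (eqP (valP A)).
by rewrite eqn0Ngt k_gt0.
Qed.

Definition KG (n k : nat) (k_gt0 : 0 < k) : sgraph :=
  SGraph (@kneser_adj_sym n k) (kneser_adj_irrefl k_gt0).

Definition is_kneser (G : sgraph) : Prop :=
  exists (n k : nat) (k_gt0 : 0 < k), k <= n /\ G = KG n k_gt0.

(* A path is given by its full vertex sequence, both endpoints included. *)
Definition path_from_to (G : sgraph) (x y : G) (q : seq G) : bool :=
  if q is z :: p then
    [&& z == x, last z p == y, path (@adj G) z p & uniq q]
  else false.

(* Paths are undirected, so q may be listed from either endpoint. *)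
Definition path_with_ends (G : sgraph) (x y : G) (q : seq G) : bool :=
  path_from_to x y q || path_from_to y x q.

Definition path_length (G : sgraph) (q : seq G) : nat := (size q).-1.

Definition path_edges (G : sgraph) (q : seq G) : seq {set G} :=
  [seq [set a.1; a.2] | a <- zip q (behead q)].

Definition internal (G : sgraph) (q : seq G) : seq G :=
  if q is z :: p then behead (belast z p) else [::].

(* The paths are indexed by the edges {u, v} of H, as unordered pairs, so that
   there is exactly one path per edge; P is irrelevant outside edges H. *)
Definition contains_totally_odd_subdivision (G H : sgraph) : Prop :=
  exists (phi : H -> G) (P : {set H} -> seq G),
    [/\ injective phi,
        forall u v : H, adj u v ->
          path_with_ends (phi u) (phi v) (P [set u; v]) /\
          odd (path_length (P [set u; v])),
        forall e f : {set H}, e \in edges H -> f \in edges H -> e != f ->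
          ~~ has (mem (path_edges (P e))) (path_edges (P f)),
        forall e f : {set H}, e \in edges H -> f \in edges H -> e != f ->
          ~~ has (mem (internal (P e))) (internal (P f))
      & forall (e : {set H}) (w : H), e \in edges H ->
          phi w \notin internal (P e)].

(* Main.v *)
Require Import Defs.
From mathcomp Require Import all_boot zify.

Set Implicit Arguments.
Unset Strict Implicit.

(**
Fix k.  Adding one point to the ground set raises the chromatic number of
KG(n,k) by at most one, because the new k-sets all share the new point and can
receive one new colour ([colorable_KG_succ]).  Starting from the edgeless graph
KG(2k-1,k), and since KG(n,k) contains arbitrarily large cliques as n grows,
every value s > 1 is the chromatic number of some KG(n,k); and then
n >= 2k+s-2, by the easy bound chi <= n-2k+2 ([chi_KG_onto]).  It is
thus enough to find one k, depending on t only, such that KG(n,k) contains K_t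
as a totally odd subdivision for all n > 2k ([KG_subdivision]).

For two disjoint sequences w of k+2 points and c of k-1 points, put
E_l = w_1..w_(l+1) c_(l+1)..c_(k-1) and O_l = c_1..c_l w_(l+3)..w_(k+2).
The k-sets E_0, O_0, E_1, O_1, ..., E_(k-1), O_(k-1) are consecutively
disjoint, so they form a walk with an odd number 2k-1 of steps ([slide]); it
leads from w_1 plus all of c to w_(k+2) plus all of c.  The sequence c is the
same for all the paths, and the terminal of the vertex i of K_t is the set c
with one extra point, tip i.  The path of an edge e = {i,j} comes from a word
w that enumerates a fixed set of letters, begins with tip i and ends with
tip j.

It remains to choose the words so that different paths do not meet.  The trace
on c of a vertex of a path gives its position (with one exception, settled by
the closing letters below in [trail_even_odd]), so two words have to be told
apart by their prefixes of the same length.  Each edge e has two private letters: the word of e takes opening e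
immediately after its first letter, before every other opening, and takes
closing e just before its last letter, after every other closing.  All the
foreign closings precede all the foreign openings.  As long as no foreign
opening has appeared, the only opening in the prefix reveals e; once they
start, all the closings but one are in the prefix, and the missing one
reveals e ([trail_same_parity]).
*)

(** * Chromatic numbers taken by KG(n,k) for fixed k *)

Section Chromatic.

Lemma colorableP (G : sgraph) m :
  reflect (exists f : G -> 'I_m, forall u v, adj u v -> f u != f v)
          (colorable G m).
Proof.
apply: (iffP existsP) => -[f fP].
  by exists f => u v; apply/implyP; move/forallP/(_ u)/forallP: fP.
exists (finfun f); apply/forallP=> u; apply/forallP=> v; rewrite !ffunE.
exact/implyP/fP.
Qed.

Lemma colorable_leq (G : sgraph) m p :
  m <= p -> colorable G m -> colorable G p.
Proof.
move=> le_mp /colorableP[f fP].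
apply/colorableP; exists (fun u => widen_ord le_mp (f u)) => u v /fP.
by apply: contra_neq => /(congr1 val) /= /val_inj.
Qed.

Lemma chi_eq (G : sgraph) m :
  colorable G m.+1 -> ~~ colorable G m -> chi G = m.+1.
Proof.
rewrite /chi => Gm1 Gm; case: ex_minnP => p Gp p_min.
apply/eqP; rewrite eqn_leq p_min //= ltnNge; apply: contra Gm => le_pm.
exact: colorable_leq le_pm Gp.
Qed.

Variables (k : nat) (k_gt0 : 0 < k).

Lemma colorable_KG_succ n m :
  colorable (KG n k_gt0) m -> colorable (KG n.+1 k_gt0) m.+1.
Proof.
case/colorableP=> f fP.
(* A k-set that avoids the new point is a k-set of the old ground set; the
   others cannot be restricted to a k-set, and all get the new colour. *)
pose low (A : {set 'I_n.+1}) : {set 'I_n} := [set i | lift ord_max i \in A].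
have card_low (A : ksubset n.+1 k) :
    ord_max \notin val A -> #|low (val A)| == k.
  move=> A_max; suff /eq_card lowK : lift ord_max @: low (val A) =i val A.
    by rewrite -(card_imset _ (@lift_inj _ ord_max)) lowK (valP A).
  move=> x; apply/imsetP/idP => [[i]|Ax].
    by rewrite inE => Ai ->.
  have [i x_i|x_max] := unliftP ord_max x.
    by exists i; rewrite // inE -x_i.
  by rewrite -x_max Ax in A_max.
pose col (A : ksubset n.+1 k) :=
  if insub (low (val A)) is Some B then lift ord_max (f B) else ord_max.
apply/colorableP; exists col => A B AB; rewrite /col.
case: insubP => [A' _ lowA|nA]; case: insubP => [B' _ lowB|nB].
- rewrite (inj_eq lift_inj) fP //.
  apply/eqP/setP=> i; rewrite !inE lowA lowB !inE.
  by move/eqP/setP/(_ (lift ord_max i)): AB; rewrite !inE.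
- by rewrite eq_sym neq_lift.
- by rewrite neq_lift.
have /negPn/= Amax := contra (@card_low A) nA.
have /negPn/= Bmax := contra (@card_low B) nB.
by move/eqP/setP/(_ ord_max): AB; rewrite !inE Amax Bmax.
Qed.

(** Two k-sets of a ground set with 2k-1 points always meet. *)
Lemma colorable_KG_base : colorable (KG (k.*2.-1) k_gt0) 1.
Proof.
apply/colorableP; exists (fun=> ord0) => A B /eqP AB.
have := max_card (mem (val A :|: val B)); rewrite card_ord.
rewrite cardsU AB cards0 (eqP (valP A)) (eqP (valP B)) subn0; lia.
Qed.

Lemma colorable_KG d : colorable (KG (k.*2.-1 + d) k_gt0) d.+1.
Proof.
elim: d => [|d IHd]; first by rewrite addn0; exact: colorable_KG_base.
by rewrite addnS; exact: colorable_KG_succ.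
Qed.

Lemma embed_ord (V : finType) n : #|V| <= n -> {g : V -> 'I_n | injective g}.
Proof.
move=> le_Vn; exists (fun x => widen_ord le_Vn (enum_rank x)) => x y.
by move=> [/ord_inj/enum_rank_inj].
Qed.

(** Disjoint blocks of k points form a clique with m+1 vertices. *)
Lemma not_colorable_KG n m : m.+1 * k <= n -> ~~ colorable (KG n k_gt0) m.
Proof.
move=> le_n; apply/negP=> /colorableP[f fP].
have [|g g_inj] := @embed_ord ('I_m.+1 * 'I_k)%type n.
  by rewrite card_prod !card_ord.
have card_block a : #|[set g (a, b) | b in 'I_k]| == k.
  by rewrite card_imset ?card_ord // => b c /g_inj[].
pose block a : KG n k_gt0 := Sub [set g (a, b) | b in 'I_k] (card_block a).
have: injective (f \o block).
  move=> a b /= /eqP fab; apply: contraTeq fab => ne_ab; apply: fP.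
  apply/eqP/setP=> x; rewrite !inE; apply/negP=> /andP[].
  move=> /imsetP[c _ ->] /imsetP[d _ /g_inj[ab _]].
  by rewrite ab eqxx in ne_ab.
by move/leq_card; rewrite !card_ord ltnn.
Qed.

(** An intermediate value argument on n: at the first n where s-1 colours are
    not enough, s colours suffice.  The upper bound on the chromatic number
    forces this n to be large. *)
Lemma chi_KG_onto s : 1 < s ->
  exists n, 2 * k + s <= n + 2 /\ chi (KG n k_gt0) = s.
Proof.
case: s => [|[|m]] // _.
pose bad d := ~~ colorable (KG (k.*2.-1 + d) k_gt0) m.+1.
have: exists d, bad d by exists (m.+2 * k); apply: not_colorable_KG; lia.
case/ex_minnP=> d d_bad d_min; exists (k.*2.-1 + d).
have lt_md : m < d.
  rewrite ltnNge; apply: contra d_bad => le_dm.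
  exact: (@colorable_leq _ d.+1 m.+1 le_dm (colorable_KG d)).
split; first lia.
apply: chi_eq d_bad; case: d lt_md d_min => // d _ d_min.
rewrite addnS; apply: colorable_KG_succ; apply: contraT => /d_min.
by rewrite ltnn.
Qed.
End Chromatic.

(** * The sliding walk of two sequences *)

Section Sliding.

Lemma mem_drop_uniq (T : eqType) (s : seq T) p x :
  uniq s -> x \in s -> (x \in drop p s) = (p <= index x s).
Proof.
rewrite -{1 2}(cat_take_drop p s) cat_uniq mem_cat => /and3P[_ disj _].
have [|/negPf xD /orP[xT|//]] := boolP (x \in drop p s).
  move=> xD _; rewrite leqNgt; apply/esym/negP.
  by move: (mem_drop xD) => /in_take <- xT; case/hasP: disj; exists x.
by rewrite leqNgt -in_take ?(mem_take xT) // xT.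
Qed.

Variables (T : eqType) (k : nat) (w c : seq T).
Hypotheses (wc_uniq : uniq (w ++ c)) (w_size : size w = k.+2).
Hypothesis c_size : (size c).+1 = k.

(** Even positions trade the end of [c] for the beginning of [w], odd ones the
    end of [w] for the beginning of [c].  The offset 2 of the suffix of
    [w] makes it disjoint from the prefix used just before (one letter is
    skipped) and from the one used just after (none is). All these lists have
    length k when [w] has k+2 letters and [c] has k-1. *)
Definition slide m : seq T :=
  if odd m then take m./2 c ++ drop m./2.+2 w
  else take m./2.+1 w ++ drop m./2 c.

Let w_uniq : uniq w. Proof. by move: wc_uniq; rewrite cat_uniq => /and3P[]. Qed.
Let c_uniq : uniq c. Proof. by move: wc_uniq; rewrite cat_uniq => /and3P[]. Qed.
Let wcF x : x \in w -> x \in c -> False.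
Proof.
move=> xw xc; move: wc_uniq; rewrite cat_uniq => /and3P[_ /hasP[]].
by exists x.
Qed.

Lemma mem_slide_w m x : x \in w ->
  (x \in slide m) = if odd m then m./2.+2 <= index x w else index x w <= m./2.
Proof.
move=> xw; have xcF := wcF xw; rewrite /slide; case: ifP => _.
  rewrite mem_cat mem_drop_uniq //; case: (boolP (x \in take _ _)) => //.
  by move/mem_take/xcF.
rewrite mem_cat in_take // ltnS; case: (boolP (x \in drop _ _)).
  by move/mem_drop/xcF.
by rewrite orbF.
Qed.

Lemma mem_slide_c m x : x \in c ->
  (x \in slide m) = if odd m then index x c < m./2 else m./2 <= index x c.
Proof.
move=> xc; have xwF xw : False := wcF xw xc; rewrite /slide; case: ifP => _.
  rewrite mem_cat in_take //; case: (boolP (x \in drop _ _)).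
    by move/mem_drop/xwF.
  by rewrite orbF.
rewrite mem_cat mem_drop_uniq //; case: (boolP (x \in take _ _)) => //.
by move/mem_take/xwF.
Qed.

Lemma slide_sub m : {subset slide m <= w ++ c}.
Proof.
move=> x; rewrite /slide; case: ifP => _; rewrite !mem_cat.
  by case/orP=> [/mem_take | /mem_drop] ->; rewrite ?orbT.
by case/orP=> [/mem_take | /mem_drop] ->; rewrite ?orbT.
Qed.

Lemma slide_uniq m : uniq (slide m).
Proof.
rewrite /slide; case: ifP => _;
  rewrite cat_uniq take_uniq // drop_uniq // andbT /=;
  apply/hasPn => x /mem_drop x1; apply/negP => /mem_take x2.
- exact: wcF x1 x2.
- exact: wcF x2 x1.
Qed.

Lemma slide_size m : m < k.*2 -> size (slide m) = k.
Proof.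
move=> lt_m; rewrite /slide; case: ifP => m_odd;
  rewrite size_cat size_drop size_take_min ?w_size; lia.
Qed.

Lemma slide_disjoint m : ~~ has (mem (slide m)) (slide m.+1).
Proof.
clear w_size c_size; apply/hasPn=> x x2 /=; apply/negP => x1.
have := slide_sub x1; rewrite mem_cat => /orP[] xs.
  by move: x1 x2; rewrite !mem_slide_w //; do 2 case: ifP; lia.
by move: x1 x2; rewrite !mem_slide_c //; do 2 case: ifP; lia.
Qed.
End Sliding.

(** * Lists of k points as vertices of KG(n,k) *)

Section KneserVertices.
Variables (n k : nat) (k_gt0 : 0 < k) (V : finType) (g : V -> 'I_n).
Hypothesis g_inj : injective g.
Variable u0 : KG n k_gt0.

(** The default [u0] is only reached by lists that do not have k distinct
    points. *)
Definition vtx (s : seq V) : KG n k_gt0 := insubd u0 [set g x | x in s].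

Lemma mem_vtx s x : uniq s -> size s = k -> (g x \in val (vtx s)) = (x \in s).
Proof.
move=> s_uniq s_size; rewrite val_insubd.
by rewrite card_imset // (card_uniqP s_uniq) s_size eqxx mem_imset.
Qed.

Lemma vtx_eq s1 s2 : s1 =i s2 -> vtx s1 = vtx s2.
Proof.
move=> s12; congr insubd; apply/setP=> y.
by apply/imsetP/imsetP=> -[x xs ->]; exists x; rewrite // ?s12 // -s12.
Qed.

Lemma vtx_adj s1 s2 : uniq s1 -> size s1 = k -> uniq s2 -> size s2 = k ->
  ~~ has (mem s1) s2 -> adj (vtx s1) (vtx s2).
Proof.
move=> u1 n1 u2 n2 /hasPn disj; rewrite /= /kneser_adj /= !val_insubd.
rewrite !card_imset // !(card_uniqP _) // n1 n2 !eqxx.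
apply/eqP/setP=> y; rewrite !inE; apply/negP=> /andP[].
case/imsetP=> x1 s1x -> /imsetP[x2 s2x /g_inj x12].
by have := disj x2 s2x; rewrite -x12 /= s1x.
Qed.
End KneserVertices.

(** * One word for each edge of the complete graph *)

Section Words.
Variables (t : nat) (i0 : 'I_t).
(* The edges of K_t are sets of two vertices.  Letters are provided for all the
   sets of vertices, which makes their number independent of the edge. *)
Notation label := {set 'I_t}.
Notation N := #|[set: {set 'I_t}]|.

Definition letter : finType := ('I_t + label + label)%type.
Definition tip (i : 'I_t) : letter := inl (inl i).
Definition opening (e : label) : letter := inl (inr e).
Definition closing (e : label) : letter := inr e.

Definition src (e : label) := head i0 (enum e).
Definition tgt (e : label) := last i0 (enum e).
Definition others (e : label) := rem e (enum [set: label]).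

(** The letters [tip i] off the edge are spelled at the boundary, after the
    foreign closings and before the foreign openings, where both private
    letters identify the edge. *)
Definition word (e : label) : seq letter :=
  (tip (src e) :: opening e :: map closing (others e)) ++
  (map tip (enum (~: e)) ++ map opening (others e)) ++
  [:: closing e; tip (tgt e)].

Lemma card_letter : #|{: letter}| = 2 * N + t.
Proof. by rewrite !card_sum card_ord cardsT -addnA addnC addnn mul2n. Qed.

Lemma tip_inj : injective tip. Proof. by move=> i j []. Qed.
Lemma opening_inj : injective opening. Proof. by move=> e f []. Qed.
Lemma closing_inj : injective closing. Proof. by move=> e f []. Qed.

Lemma mem_others (e f : label) : (f \in others e) = (f != e).
Proof. by rewrite mem_rem_uniq ?enum_uniq // inE mem_enum in_setT andbT. Qed.

Lemma size_others (e : label) : (size (others e)).+1 = N.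
Proof.
rewrite size_rem ?mem_enum ?in_setT // -cardE prednK //.
by apply/card_gt0P; exists e.
Qed.

Lemma edge_ends (e : label) :
  #|e| = 2 -> e = [set src e; tgt e] /\ src e != tgt e.
Proof.
rewrite cardE /src /tgt; have:= enum_uniq e; have:= mem_enum e.
case: (enum e) => [|i [|j []]] //= eE; rewrite inE andbT => ij _.
by split=> //; apply/setP=> x; rewrite -eE !inE.
Qed.

Lemma size_word (e : label) : #|e| = 2 -> size (word e) = 2 * N + t.
Proof.
move=> e2; have := cardsC e; rewrite card_ord e2 [#|~: e|]cardE.
by rewrite -(size_others e) /word /= !size_cat /= !size_map; lia.
Qed.

Lemma mem_word (e : label) a : #|e| = 2 -> a \in word e.
Proof.
move=> e2; have [eE _] := edge_ends e2.
rewrite /word !(mem_cat, inE); case: a => [[i|f]|f].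
- have -> : inl (inl i) = tip i by [].
  have iE : (i \in e) = (i == src e) || (i == tgt e) by rewrite {1}eE !inE.
  rewrite !(inj_eq tip_inj) (mem_map tip_inj) mem_enum in_setC iE.
  by do 2 case: eqP => //=; rewrite !orbT.
- have -> : inl (inr f) = opening f by [].
  rewrite !(inj_eq opening_inj) (mem_map opening_inj) mem_others.
  by case: (f == e); rewrite ?orbT.
have -> : inr f = closing f by [].
rewrite !(inj_eq closing_inj) (mem_map closing_inj) mem_others.
by case: (f == e); rewrite ?orbT.
Qed.

(** A word that contains every letter and has as many places as there are
    letters cannot repeat any. *)
Lemma word_uniq (e : label) : #|e| = 2 -> uniq (word e).
Proof.
move=> e2; rewrite (uniq_size_uniq (enum_uniq letter)) => [|a].
  by rewrite size_word // -cardE card_letter.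
by rewrite mem_enum mem_word.
Qed.

Lemma index_opening_self (e : label) : index (opening e) (word e) = 1.
Proof. by rewrite /= eqxx. Qed.

Lemma index_opening_other (e f : label) :
  f != e -> N < index (opening f) (word e).
Proof.
move=> fe; rewrite -(size_others e) /word index_cat ifN /=.
  by rewrite size_map; lia.
rewrite !inE (inj_eq opening_inj) negb_or /= (negPf fe) /=.
by apply/mapP=> -[].
Qed.

Lemma index_closing_other (e f : label) :
  f != e -> index (closing f) (word e) <= N.
Proof.
move=> fe; rewrite -(size_others e) /word index_cat ifT.
  have : closing f \in map closing (others e).
    by rewrite (mem_map closing_inj) mem_others.
  by rewrite -index_mem size_map /=; lia.
by rewrite !inE /= (mem_map closing_inj) mem_others.
Qed.

Lemma index_closing_self (e : label) :
  #|e| = 2 -> (index (closing e) (word e)).+2 = size (word e).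
Proof.
move=> e2; rewrite /word catA index_cat ifN.
  by rewrite !size_cat /= eqxx; lia.
rewrite !mem_cat !inE (mem_map closing_inj) mem_others eqxx /= !negb_or.
by apply/andP; split; apply/mapP=> -[].
Qed.

Lemma index_closing_gt1 (e f : label) : 1 < index (closing f) (word e).
Proof. by []. Qed.

Lemma drop_word_last (e : label) :
  drop (size (word e)).-1 (word e) = [:: tip (tgt e)].
Proof.
rewrite /word -(cat1s (closing e)) !catA size_cat addn1 /=.
by rewrite drop_size_cat.
Qed.
End Words.

(** * Paths listed by a function of the position *)

Section IndexedPaths.
Variables (G : sgraph) (f : nat -> G).

Lemma last_iotaS m p : last m (iota m.+1 p) = m + p.
Proof. by elim: p m => [|p IHp] m /=; rewrite ?addn0 // IHp addnS. Qed.

Lemma belast_iotaS m p : belast m (iota m.+1 p) = iota m p.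
Proof. by elim: p m => [|p IHp] m //=; rewrite IHp. Qed.

Lemma mkseqS p : mkseq f p.+1 = f 0 :: map f (iota 1 p).
Proof. by []. Qed.

Lemma internal_mkseq p : internal (mkseq f p.+1) = map f (iota 1 p.-1).
Proof. by rewrite /= belast_map belast_iotaS; case: p. Qed.

Lemma path_mkseq p : (forall m, m < p -> adj (f m) (f m.+1)) ->
  path (@adj G) (f 0) (map f (iota 1 p)).
Proof.
have gen q m : m + q <= p -> (forall m, m < p -> adj (f m) (f m.+1)) ->
    path (@adj G) (f m) (map f (iota m.+1 q)).
  elim: q m => //= q IHq m le_mq fP; rewrite fP ?IHq //; lia.
exact: gen.
Qed.

Lemma path_from_to_mkseq p :
  (forall m, m < p -> adj (f m) (f m.+1)) -> uniq (mkseq f p.+1) ->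
  path_from_to (f 0) (f p) (mkseq f p.+1).
Proof.
rewrite mkseqS => /path_mkseq f_path f_uniq.
by rewrite /path_from_to f_uniq f_path last_map last_iotaS !eqxx.
Qed.

Lemma path_edges_mkseq p :
  path_edges (mkseq f p.+1) = [seq [set f m; f m.+1] | m <- iota 0 p].
Proof.
have gen m : zip (map f (iota m p.+1)) (map f (iota m.+1 p)) =
             [seq (f m, f m.+1) | m <- iota m p].
  by elim: p m => //= p IHp m; rewrite -IHp.
rewrite /path_edges /mkseq [behead _]/= gen -map_comp.
by apply: eq_map.
Qed.
End IndexedPaths.

(** * The subdivision of the complete graph *)

Section Subdivision.
Variables (t n k : nat) (i0 : 'I_t) (k_gt0 : 0 < k).
Notation label := {set 'I_t}.
Notation N := #|[set: {set 'I_t}]|.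
Hypothesis k_def : k.+2 = 2 * N + t.

Definition ground : finType := (letter t + 'I_k.-1)%type.
Definition core_point (j : 'I_k.-1) : ground := inr j.
Variables (g : ground -> 'I_n) (g_inj : injective g) (u0 : KG n k_gt0).

Definition front (e : label) : seq ground := map inl (word i0 e).
Definition core : seq ground := map core_point (enum 'I_k.-1).
Definition terminal (i : 'I_t) := vtx g u0 (inl (tip i) :: core).
Definition trail (e : label) m := vtx g u0 (slide (front e) core m).

Lemma mem_core j : core_point j \in core.
Proof. by rewrite mem_map ?mem_enum // => i i' []. Qed.

Lemma inl_notin_core x : inl x \notin core.
Proof. by apply/mapP=> -[]. Qed.

Lemma core_uniq : uniq core.
Proof. by rewrite map_inj_uniq ?enum_uniq // => i i' []. Qed.

Lemma size_core : (size core).+1 = k.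
Proof. by rewrite size_map -cardE card_ord prednK. Qed.

Lemma index_core j : index (core_point j) core = j.
Proof. by rewrite index_map ?index_enum_ord // => i i' []. Qed.

Lemma mem_terminal_core i j : g (core_point j) \in val (terminal i).
Proof.
rewrite mem_vtx ?inE ?mem_core ?orbT //= ?size_core //.
by rewrite inl_notin_core core_uniq.
Qed.

Lemma mem_terminal_tip i j : (g (inl (tip j)) \in val (terminal i)) = (j == i).
Proof.
rewrite mem_vtx ?inE //= ?size_core ?inl_notin_core ?core_uniq //.
by rewrite (negPf (inl_notin_core _)) orbF !(inj_eq (@inl_inj _ _)).
Qed.

Lemma terminal_inj : injective terminal.
Proof.
by move=> i j ij; apply/eqP; rewrite -mem_terminal_tip -ij mem_terminal_tip.
Qed.

Section Edge.
Variable e : label.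
Hypothesis e2 : #|e| = 2.

Lemma front_core_uniq : uniq (front e ++ core).
Proof.
rewrite cat_uniq core_uniq andbT map_inj_uniq ?word_uniq //=; last first.
  exact: inl_inj.
by apply/hasPn=> x /mapP[j _ ->]; apply/mapP=> -[].
Qed.

Lemma size_front : size (front e) = k.+2.
Proof. by rewrite size_map size_word. Qed.

Lemma mem_trail_letter m x : m < k.*2 ->
  (g (inl x) \in val (trail e m)) =
  if odd m then m./2.+2 <= index x (word i0 e) else index x (word i0 e) <= m./2.
Proof.
have uniq_fc := front_core_uniq; have size_f := size_front.
have size_c := size_core => lt_m.
rewrite mem_vtx ?slide_uniq ?(slide_size uniq_fc size_f) //.
by rewrite mem_slide_w ?index_map ?mem_map ?mem_word //; apply: inl_inj.
Qed.

Lemma mem_trail_core m j : m < k.*2 ->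
  (g (core_point j) \in val (trail e m)) =
  if odd m then j < m./2 else m./2 <= j.
Proof.
have uniq_fc := front_core_uniq; have size_f := size_front.
have size_c := size_core => lt_m.
rewrite mem_vtx ?slide_uniq ?(slide_size uniq_fc size_f) //.
by rewrite mem_slide_c ?index_core ?mem_core.
Qed.

Lemma trail_adj m : m.+1 < k.*2 -> adj (trail e m) (trail e m.+1).
Proof.
have uniq_fc := front_core_uniq; have size_f := size_front.
have size_c := size_core => lt_m.
have lt_m' := ltnW lt_m.
apply: vtx_adj; rewrite ?slide_uniq ?(slide_size uniq_fc size_f) //.
exact: slide_disjoint uniq_fc _.
Qed.

Lemma trail_first : trail e 0 = terminal (src i0 e).
Proof. by apply: vtx_eq => x; rewrite /slide /= drop0. Qed.

Lemma trail_last : trail e (k.*2.-1) = terminal (tgt i0 e).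
Proof.
have m_odd : odd k.*2.-1 by lia.
have m_half : (k.*2.-1)./2 = k.-1 by lia.
apply: vtx_eq => x; rewrite /slide m_odd m_half take_oversize; last first.
  by rewrite -size_core.
have -> : k.-1.+2 = (size (word i0 e)).-1 by rewrite size_word // -k_def; lia.
by rewrite -map_drop drop_word_last mem_cat orbC !inE.
Qed.

Lemma edge_k_gt1 : 1 < k.
Proof.
have : 0 < N by apply/card_gt0P; exists e.
by have := max_card (mem e); rewrite e2 card_ord; lia.
Qed.

(** A terminal contains the whole core, whereas the walk has given up the first
    core point or not yet gained the last one. *)
Lemma trail_neq_terminal m i : 0 < m < k.*2.-1 -> trail e m <> terminal i.
Proof.
have k_gt1 := edge_k_gt1 => lt_m eq_m.
have CP j : j < k.-1 -> if odd m then j < m./2 else m./2 <= j.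
  move=> lt_j; rewrite -(mem_trail_core (Ordinal lt_j)); last lia.
  by rewrite eq_m mem_terminal_core.
have := CP 0; have := CP k.-2; case: ifP; lia.
Qed.
End Edge.

(** Even vertices contain a final segment of the core and odd ones an initial
    segment; unless they are the whole core, these can only agree when both are
    empty.  The first vertex is then the word of e without its last two letters
    and the second the word of f without its first two, so that [closing e] is
    absent from the first and present in the second. *)
Lemma trail_even_odd (e f : label) m m' : #|e| = 2 -> #|f| = 2 ->
  0 < m < k.*2 -> m' < k.*2.-1 -> ~~ odd m -> odd m' ->
  trail e m <> trail f m'.
Proof.
move=> e2 f2 /andP[m_gt0 lt_m] lt_m' m_even m'_odd eq_m.
have k_gt1 := edge_k_gt1 e2; have lt_m'k : m' < k.*2 by lia.
have CP j : j < k.-1 -> (m./2 <= j) = (j < m'./2).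
  move=> lt_j; have := mem_trail_core e2 (Ordinal lt_j) lt_m.
  by rewrite eq_m mem_trail_core // (negPf m_even) m'_odd.
have m_last : m./2 = k.-1 by have := CP 0; have := CP k.-2; lia.
have m'_0 : m'./2 = 0 by have := CP 0; lia.
have := mem_trail_letter e2 (closing e) lt_m; rewrite eq_m mem_trail_letter //.
rewrite (negPf m_even) m'_odd m_last m'_0 index_closing_gt1.
by have := index_closing_self i0 e2; rewrite size_word // -k_def; lia.
Qed.

(** The core gives the position.  Then [opening e] tells the two words apart
    while the prefix has at most N+1 letters, and [closing e] afterwards: the
    change of regime occurs at the same length in all the words. *)
Lemma trail_same_parity (e f : label) m m' : #|e| = 2 -> #|f| = 2 ->
  0 < m < k.*2.-1 -> m' < k.*2 -> odd m = odd m' ->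
  trail e m = trail f m' -> m = m' /\ e = f.
Proof.
move=> e2 f2 /andP[m_gt0 lt_m] lt_m' m_m' eq_m.
have k_gt1 := edge_k_gt1 e2; have lt_mk : m < k.*2 by lia.
have mm' : m = m'.
  have CP j : j < k.-1 -> (m./2 <= j) = (m'./2 <= j).
    move=> lt_j; have := mem_trail_core e2 (Ordinal lt_j) lt_mk.
    rewrite eq_m mem_trail_core // m_m' /=; case: ifP => _; lia.
  by have := CP m./2; have := CP m'./2; lia.
split=> //; apply/eqP/negPn/negP => ne_ef.
have opening_f := index_opening_other i0 ne_ef.
have closing_f := index_closing_other i0 ne_ef.
have closing_e := index_closing_self i0 e2.
rewrite size_word // -k_def in closing_e.
have := mem_trail_letter e2 (opening e) lt_mk.
have := mem_trail_letter e2 (closing e) lt_mk.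
rewrite eq_m -mm' (mem_trail_letter f2 (opening e) lt_mk).
rewrite (mem_trail_letter f2 (closing e) lt_mk) index_opening_self.
move: opening_f closing_f closing_e.
move: (index _ _) (index _ _) (index _ _) => x y z.
move=> opening_f closing_f closing_e.
have : m./2 < k by lia.
case: ifP => m_odd; last by have : 0 < m./2 by [lia]; lia.
have : m./2.+1 < k by lia.
lia.
Qed.

(** An inner vertex determines both its edge and its position.  This one fact
    makes each path simple, and different paths disjoint. *)
Lemma trail_inj (e f : label) m m' : #|e| = 2 -> #|f| = 2 ->
  0 < m < k.*2.-1 -> m' < k.*2 -> trail e m = trail f m' -> m = m' /\ e = f.
Proof.
move=> e2 f2 lt_m lt_m' eq_m.
case: (eqVneq (odd m) (odd m')) => [m_m'|m_m'].
  exact: trail_same_parity eq_m.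
case: (boolP (odd m)) m_m' => m_odd m_m'.
  have [m'0|m'_gt0] := posnP m'.
    by move: eq_m; rewrite m'0 trail_first => /(trail_neq_terminal e2 lt_m).
  by case: (@trail_even_odd f e m' m) => //; lia.
have [m'_last|ne_m'] := eqVneq m' k.*2.-1.
  by move: eq_m; rewrite m'_last trail_last // => /(trail_neq_terminal e2 lt_m).
by case: (@trail_even_odd e f m m') => //; lia.
Qed.

Let last_k : k.*2 = k.*2.-1.+1. Proof. lia. Qed.

Lemma trail_uniq (e : {set 'I_t}) : #|e| = 2 -> uniq (mkseq (trail e) k.*2).
Proof.
move=> e2; have [_ ne_ends] := edge_ends i0 e2.
have inj m m' : m < m' -> m' < k.*2 -> trail e m = trail e m' -> False.
  move=> lt_mm' lt_m' eq_m; have [m0|m_gt0] := posnP m; last first.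
    by case: (@trail_inj e e m m' e2 e2 _ _ eq_m) => //; lia.
  have [m'_last|ne_m'] := eqVneq m' k.*2.-1.
    move: eq_m; rewrite m0 m'_last trail_first (trail_last e2).
    by move/terminal_inj/eqP; apply/negP.
  have eq_m' := esym eq_m.
  by case: (@trail_inj e e m' m e2 e2 _ _ eq_m') => //; lia.
apply/mkseq_uniqP=> m m' lt_m lt_m' eq_m.
case: (ltngtP m m') => // lt_mm'; first by case: (inj _ _ lt_mm' lt_m' eq_m).
by case: (inj _ _ lt_mm' lt_m (esym eq_m)).
Qed.

Lemma trail_path (e : {set 'I_t}) : #|e| = 2 ->
  path_from_to (terminal (src i0 e)) (terminal (tgt i0 e))
    (mkseq (trail e) k.*2).
Proof.
move=> e2; rewrite -(trail_first e) -(trail_last e2) last_k.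
apply: path_from_to_mkseq => [m lt_m|]; last by rewrite -last_k trail_uniq.
by apply: trail_adj => //; lia.
Qed.

Lemma trail_path_with_ends (e : {set 'I_t}) u v : #|e| = 2 ->
  e = [set u; v] -> u != v ->
  path_with_ends (terminal u) (terminal v) (mkseq (trail e) k.*2).
Proof.
move=> e2 eE ne_uv; have [eE' _] := edge_ends i0 e2.
have t_path := trail_path e2.
have /set2P uP : u \in [set src i0 e; tgt i0 e] by rewrite -eE' eE set21.
have /set2P vP : v \in [set src i0 e; tgt i0 e] by rewrite -eE' eE set22.
rewrite /path_with_ends; move: ne_uv.
case: uP => ->; case: vP => ->; rewrite ?eqxx // => _.
  by apply/orP; left.
by apply/orP; right.
Qed.

Lemma edge_card (e : {set 'I_t}) : e \in edges (complete_graph t) -> #|e| = 2.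
Proof.
case/imset2P=> u v _; rewrite inE => /andP[_ uv] ->.
by rewrite cards2 (uv : u != v).
Qed.

Lemma mem_internal (e : {set 'I_t}) A :
  A \in internal (mkseq (trail e) k.*2) ->
  exists2 m, 0 < m < k.*2.-1 & A = trail e m.
Proof.
rewrite last_k internal_mkseq => /mapP[m]; rewrite mem_iota => m_int ->.
by exists m => //; lia.
Qed.

Lemma mem_path_edges (e : {set 'I_t}) E :
  E \in path_edges (mkseq (trail e) k.*2) ->
  exists2 m, m.+1 < k.*2 & E = [set trail e m; trail e m.+1].
Proof.
rewrite last_k path_edges_mkseq => /mapP[m]; rewrite mem_iota => m_int ->.
by exists m => //; lia.
Qed.

Lemma trails_subdivision :
  contains_totally_odd_subdivision (KG n k_gt0) (complete_graph t).
Proof.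
exists terminal, (fun e => mkseq (trail e) k.*2).
split=> [|u v uv|e f /edge_card e2 /edge_card f2 ne_ef
         |e f /edge_card e2 /edge_card f2 ne_ef|e w /edge_card e2].
- exact: terminal_inj.
- have e2 : #|[set u; v]| = 2 by rewrite cards2 (uv : u != v).
  split; first exact: trail_path_with_ends.
  by rewrite /path_length size_mkseq; lia.
- apply/hasPn=> E /mem_path_edges[m' lt_m' ->]; apply/negP.
  move=> /mem_path_edges[m lt_m eq_E]; case/eqP: ne_ef.
  have k_gt1 := edge_k_gt1 e2.
  (* A path has at least three edges, so each of them has an inner end. *)
  have [q q_int Eq] : exists2 q, 0 < q < k.*2.-1 &
      trail e q \in [set trail f m'; trail f m'.+1].
    have [m0|m_gt0] := posnP m.
      by exists m.+1; [lia | rewrite eq_E set22].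
    by exists m; [lia | rewrite eq_E set21].
  by case/set2P: Eq => /trail_inj[] //; exact: ltnW.
- apply/hasPn=> A /mem_internal[m' lt_m' ->]; apply/negP.
  move=> /mem_internal[m lt_m] eq_m; case/eqP: ne_ef.
  have lt_m'k : m' < k.*2 by lia.
  by case: (trail_inj e2 f2 lt_m lt_m'k (esym eq_m)).
apply/negP=> /mem_internal[m lt_m] /esym.
exact: trail_neq_terminal.
Qed.
End Subdivision.

(** Here k+2 is the number of letters, and the letters together with the core
    make up the 2k+1 points of the ground set that the paths visit. *)
Lemma KG_subdivision t n k (k_gt0 : 0 < k) : 0 < t ->
  k.+2 = 2 * #|[set: {set 'I_t}]| + t -> k.*2 < n ->
  contains_totally_odd_subdivision (KG n k_gt0) (complete_graph t).
Proof.
move=> t_gt0 k_def lt_kn.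
have [g g_inj] : {g : ground t k -> 'I_n | injective g}.
  apply: embed_ord; rewrite card_sum card_letter -k_def card_ord; lia.
have [h h_inj] : {h : 'I_k -> 'I_n | injective h}.
  by apply: embed_ord; rewrite card_ord; lia.
have card_h : #|h @: 'I_k| == k by rewrite card_imset ?card_ord.
pose u0 : KG n k_gt0 := Sub (h @: 'I_k) card_h.
exact (@trails_subdivision t n k (Ordinal t_gt0) k_gt0 k_def g g_inj u0).
Qed.

Unset Implicit Arguments.

Theorem theorem1p2 (s t : nat) (hs : 8 <= s) (ht : 1 <= t) :
  exists G : sgraph,
    [/\ is_kneser G,
        chi G = s
      & contains_totally_odd_subdivision G (complete_graph t)].
Proof.
pose k := (2 * #|[set: {set 'I_t}]| + t).-2.
have N_gt0 : 0 < #|[set: {set 'I_t}]| by apply/card_gt0P; exists set0.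
have k_gt0 : 0 < k by rewrite /k; lia.
have k_def : k.+2 = 2 * #|[set: {set 'I_t}]| + t by rewrite /k; lia.
have [|n [le_n chi_n]] := @chi_KG_onto k k_gt0 s; first lia.
exists (KG n k_gt0); split=> //; first by exists n, k, k_gt0; split=> //; lia.
by apply: KG_subdivision => //; lia.
Qed.
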